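(* For any constant $C>0$, with probability at least $1-o(1)$, \[\Big|\frac{N_{d_n^*}}{(1-\lambda_n)n}-1\Big|<\frac{C}{\log\log n}\qquad\text{and}\qquad\Big|\frac{N_{d_n^*+1}}{n}-\lambda_n\Big|<\frac{C}{\log\log n}.\]
   Context: Let $(\alpha_n)$ be a sequence in $(0,\infty)$ with $0<\liminf\alpha_n\le\limsup\alpha_n<\infty$, $q_n=\alpha_n\log n/n$, $G_n\sim\mathcal G(n,q_n)$ on $\{1,\dots,n\}$, $d_n^*=\min\{d\in\mathbb Z:(nq_n)^d\ge n/(\log\log n)^2\}$, and $\lambda_n\in(0,1)$ defined by $\log(1/\lambda_n)=(nq_n)^{d_n^*}/n$. $N_d$ is the number of vertices of $G_n$ at graph distance exactly $d$ from vertex $1$. *)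

(* Defs.v *)
From mathcomp Require Export all_boot all_order all_algebra.
From mathcomp Require Export all_classical all_reals all_analysis.

Set Implicit Arguments.
Unset Strict Implicit.
Unset Printing Implicit Defensive.

Import Order.TTheory GRing.Theory Num.Theory.
Import numFieldNormedType.Exports.

Local Open Scope classical_set_scope.
Local Open Scope ring_scope.

Section Distance.
Variables (T : finType) (e : rel T).

Definition walk (k : nat) (x y : T) : bool :=
  [exists p : k.-tuple T, path e x p && (last x p == y)].

(* [None] stands for the infinite distance. *)
Definition gdist (x y : T) : option nat :=
  match pselect (exists k, walk k x y) with
  | left ex_walk => Some (ex_minn ex_walk)
  | right _ => None
  end.

(* The radius is an integer because [dstar] below is a minimum over all of
   the integers; no vertex lies at a negative distance. *)
Definition sphere_size (x : T) (d : int) : nat :=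
  #|[set y | omap Posz (gdist x y) == Some d]%SET|.

End Distance.

(* A simple graph on {1, ..., n} is its set of edges, each edge being a
   2-element subset of 'I_n; the vertex i + 1 is the ordinal of value i. *)
Definition vpairs (n : nat) : {set {set 'I_n}} :=
  [set p : {set 'I_n} | #|p| == 2%N]%SET.

Definition graphs (n : nat) : {set {set {set 'I_n}}} := powerset (vpairs n).

Definition adj (n : nat) (G : {set {set 'I_n}}) : rel 'I_n :=
  fun x y => [set x; y]%SET \in G.

Section ErdosRenyi.
Variable R : realType.

Definition gnp_mass (n : nat) (q : R) (G : {set {set 'I_n}}) : R :=
  \prod_(p in vpairs n) (if p \in G then q else 1 - q).

(* A genuine probability only when 0 <= q <= 1. *)
Definition gnp_prob (n : nat) (q : R) (A : pred {set {set 'I_n}}) : R :=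
  \sum_(G in graphs n | A G) gnp_mass q G.

Variable alpha : nat -> R.

(* Can exceed 1, but only for finitely many n when alpha is bounded. *)
Definition edge_prob (n : nat) : R := alpha n * ln n%:R / n%:R.

Definition dstar_set (n : nat) : set int :=
  [set d : int | n%:R / ln (ln n%:R) ^+ 2 <= (n%:R * edge_prob n) ^ d].

(* The least element of [dstar_set n]; the default value 0 is only used when
   there is none, which [dstarP] rules out as soon as n * q_n > 1. *)
Definition dstar (n : nat) : int :=
  xget 0 (dstar_set n `&` lbound (dstar_set n)).

(* The solution of log (1 / lambda) = (n q_n)^(d_n^* ) / n, see
   [ln_lambda_inv]. *)
Definition lambda (n : nat) : R :=
  expR (- ((n%:R * edge_prob n) ^ dstar n / n%:R)).

Lemma ln_lambda_inv (n : nat) :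
  ln (1 / lambda n) = (n%:R * edge_prob n) ^ dstar n / n%:R.
Proof. by rewrite /lambda expRN div1r invrK expRK. Qed.

Lemma dstarP (n : nat) : 0 < ln (ln n%:R) ^+ 2 :> R ->
  1 < n%:R * edge_prob n ->
  dstar_set n (dstar n) /\ lbound (dstar_set n) (dstar n).
Proof.
move=> lln_gt0 x_gt1; set x := n%:R * edge_prob n in x_gt1.
have x_gt0 : 0 < x by rewrite (lt_trans _ x_gt1).
have n_gt0 : (0 < n)%N.
  by case: n @x x_gt1 {lln_gt0 x_gt0} => //=; rewrite mul0r ltr10.
have t_gt0 : 0 < n%:R / ln (ln n%:R) ^+ 2 :> R by rewrite divr_gt0 ?ltr0n.
set t : R := n%:R / _ in t_gt0.
have big (s : R) : exists k : nat, s < x ^+ k.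
  have cv : geometric 1 x^-1 @ \oo --> (0 : R).
    by apply: cvg_geometric; rewrite gtr0_norm ?invr_gt0 ?invf_lt1.
  have s'_gt0 : 0 < (`|s| + 1)^-1 by rewrite invr_gt0 ltr_wpDl.
  have /cvgr_dist_lt /(_ _ s'_gt0) [k _ /(_ k (leqnn k))/=] := cv.
  rewrite sub0r normrN mul1r exprVn gtr0_norm ?invr_gt0 ?exprn_gt0 //.
  rewrite ltf_pV2 ?posrE ?exprn_gt0 ?ltr_wpDl // => sk; exists k.
  by apply: le_lt_trans sk; rewrite (le_trans (ler_norm s)) // lerDl.
have [k tk] := big t; have [l tl] := big t^-1.
have low (d : int) : t <= x ^ d -> - l%:Z <= d.
  move=> td; rewrite leNgt; apply/negP => dl.
  have : x ^ d <= x ^ (- l%:Z) by rewrite ler_eXz2l // ltW.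
  rewrite leNgt => /negP; apply; apply: lt_le_trans td.
  by rewrite -invr_expz /= invf_plt ?posrE ?exprn_gt0.
pose P (m : nat) := t <= x ^ (m%:Z - l%:Z).
have exP : exists m, P m.
  by exists (k + l)%N; rewrite /P PoszD addrK ltW.
suff : (dstar_set n `&` lbound (dstar_set n)) (dstar n) by case.
case: (ex_minnP exP) => m Pm mmin.
apply: (@xgetI _ 0 _ (m%:Z - l%:Z)); split => // d /= td.
have := low d td; rewrite -subr_ge0 opprK => dl_ge0.
have : (m <= `|(d + l%:Z)%R|)%N by apply: mmin; rewrite /P gez0_abs // addrK.
by rewrite -lez_nat gez0_abs // lerBlDr.
Qed.

End ErdosRenyi.

(* Main.v *)
(** Explore G(n, q) from the vertex v by breadth-first search and let (V, F) be
    the ball and the sphere of radius k.  The event that the state is (V, F)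
    depends only on the pairs meeting V \ F, while the next sphere depends only
    on the pairs between F and the complement of V.  Hence, given (V, F), the
    next sphere has a binomial size of mean (n - |V|) (1 - (1 - q)^|F|), and
    Chebyshev's inequality applies level by level.  With x = n q and
    w = (log log n)^-2, tolerances w 2^-k at level k keep the sphere sizes
    within a factor 1 + O(w) of x^k up to level dstar - 1, where x^k <= w n, and
    the failure probabilities add up to O(1 / (w^2 x)).  One more step gives
    (1 - lambda) n up to a relative error O(w), because s |-> 1 - exp (- s) is
    concave and vanishes at 0.  In the last step each remaining vertex is missed
    with probability at most w, so that nearly all the lambda n remaining
    vertices are reached.  Finally w is o(1 / log log n). *)

Require Import Defs.
From mathcomp Require Import all_boot all_order all_algebra.
From mathcomp Require Import all_classical all_reals all_analysis.
From mathcomp Require Import ring lra.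

Set Implicit Arguments.
Unset Strict Implicit.
Unset Printing Implicit Defensive.

Import Order.TTheory GRing.Theory Num.Theory.
Import numFieldNormedType.Exports.

Local Open Scope ring_scope.

(** * Random subsets with independent elements *)

Section BernoulliSubsets.
Import mathcomp.boot.fintype mathcomp.boot.finset.
Local Open Scope set_scope.
Local Open Scope ring_scope.
Variables (R : realFieldType) (T : finType) (q : R).
Implicit Types (A B D G S : {set T}) (f g : {set T} -> R).

(** The expectation of f over a random subset of D to which each element belongs independently with
    probability q, as a polynomial in q. *)
Definition bern_exp D f : R :=
  \sum_(G in powerset D) (\prod_(e in D) (if e \in G then q else 1 - q)) * f G.

(** Measurability with respect to the membership of the elements of A. *)
Definition depends_on A (X : Type) (f : {set T} -> X) :=
  forall G, f (G :&: A) = f G.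

Lemma set_ind_U1 (P : {set T} -> Prop) :
  P set0 -> (forall e D, e \notin D -> P D -> P (e |: D)) -> forall D, P D.
Proof.
move=> P0 PU D; elim: {D}_.+1 {-2}D (ltnSn #|D|) => // m IH D Dm.
have [->//|[e eD]] := set_0Vmem D.
rewrite -(setD1K eD); apply: PU; first by rewrite !inE eqxx.
by apply: IH; rewrite (cardsD1 e D) eD in Dm.
Qed.

Lemma eq_bern_exp D f g : f =1 g -> bern_exp D f = bern_exp D g.
Proof. by move=> fg; apply: eq_bigr => G _; rewrite fg. Qed.

Lemma bern_exp0 f : bern_exp set0 f = f set0.
Proof.
by rewrite /bern_exp powerset0 big_set1 big_pred0 ?mul1r // => e; rewrite inE.
Qed.

(** Conditioning on e: the subsets that contain e are reindexed by removing it. The inductions on D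
    below rest on this recursion. *)
Lemma bern_expU1 D e f : e \notin D ->
  bern_exp (e |: D) f =
  q * bern_exp D (fun G => f (e |: G)) + (1 - q) * bern_exp D f.
Proof.
move=> eD; rewrite /bern_exp (bigID (fun G => e \in G)) /=; congr (_ + _).
- rewrite big_distrr /=.
  rewrite (reindex_onto (fun G => e |: G) (fun G => G :\ e)) /=; last first.
    by move=> G /andP[_ eG]; rewrite setD1K.
  apply: eq_big => [G|G].
    rewrite !powersetE setU11 andbT.
    apply/andP/idP => [[sG /eqP eG]|sG].
      have eNG : e \notin G by rewrite -eG !inE eqxx.
      by rewrite -eG subDset.
    split; first by rewrite setUS.
    rewrite setU1K //; apply: contra eD; exact: (subsetP sG e).
  rewrite big_setU1 //= setU11 mulrA => _; congr (_ * _ * _).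
  apply: eq_bigr => i iD; rewrite !inE; case: eqP => // ie.
  by rewrite -ie iD in eD.
- rewrite big_distrr /=; apply: eq_big => [G|G /andP[_ eG]].
    rewrite !powersetE; apply/andP/idP => [[sG eG]|sG].
      apply/subsetP => i iG; have := subsetP sG i iG.
      by rewrite !inE => /predU1P[ie|//]; rewrite -ie iG in eG.
    split; first by rewrite (subset_trans sG) ?subsetUr.
    apply: contra eD; exact: (subsetP sG e).
  by rewrite big_setU1 //= (negbTE eG) mulrA.
Qed.

Lemma bern_expD D f g :
  bern_exp D (fun G => f G + g G) = bern_exp D f + bern_exp D g.
Proof.
by rewrite /bern_exp -big_split; apply: eq_bigr => G _; rewrite mulrDr.
Qed.

Lemma bern_expZ D c f : bern_exp D (fun G => c * f G) = c * bern_exp D f.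
Proof. by rewrite /bern_exp big_distrr; apply: eq_bigr => G _; rewrite mulrCA. Qed.

Lemma bern_exp_sum (I : finType) (P : pred I) D (F : I -> {set T} -> R) :
  bern_exp D (fun G => \sum_(i | P i) F i G) = \sum_(i | P i) bern_exp D (F i).
Proof.
by rewrite /bern_exp exchange_big; apply: eq_bigr => G _; rewrite big_distrr.
Qed.

Lemma bern_exp_cst D c : bern_exp D (fun=> c) = c.
Proof.
elim/set_ind_U1: D => [|e D eD IH]; first by rewrite bern_exp0.
by rewrite bern_expU1 // IH; ring.
Qed.

Lemma depends_onU1 A (X : Type) (f : {set T} -> X) e :
  depends_on A f -> depends_on A (fun G => f (e |: G)).
Proof.
move=> fA G; rewrite -fA -[RHS]fA; congr (f _); apply/setP => i.
by rewrite !inE; case: (i == e) => //=; case: (i \in A); rewrite ?andbT ?andbF.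
Qed.

Lemma depends_on_notin A (X : Type) (f : {set T} -> X) e : e \notin A ->
  depends_on A f -> (fun G => f (e |: G)) =1 f.
Proof.
move=> eA fA G; rewrite -fA -[RHS]fA; congr (f _); apply/setP => i.
by rewrite !inE; case: eqP => // ->; rewrite (negbTE eA) !andbF.
Qed.

(** Induction on D, conditioning on each new element: it lies outside A or outside B, so one of the
    two factors ignores it. *)
Lemma bern_exp_indep D A B f g : [disjoint A & B] ->
  depends_on A f -> depends_on B g ->
  bern_exp D (fun G => f G * g G) = bern_exp D f * bern_exp D g.
Proof.
move=> dAB; elim/set_ind_U1: D f g => [f g _ _|e D eD IH f g fA gB].
  by rewrite !bern_exp0.
rewrite !bern_expU1 // !IH //; do 2?exact: depends_onU1.
have [eA|eA] := boolP (e \in A).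
  have eB : e \notin B by rewrite (disjointFr dAB).
  by rewrite !(eq_bern_exp D (depends_on_notin eB gB)); ring.
by rewrite !(eq_bern_exp D (depends_on_notin eA fA)); ring.
Qed.

(** Each element of S must be left out, which costs a factor 1 - q; for any other element both
    outcomes agree and their weights add up to 1. *)
Lemma bern_exp_avoid D S : S \subset D ->
  bern_exp D (fun G => [disjoint S & G]%:R) = (1 - q) ^+ #|S|.
Proof.
elim/set_ind_U1: D S => [S|e D eD IH S sS].
  rewrite subset0 => /eqP ->.
  by rewrite bern_exp0 disjoints_subset sub0set cards0.
have depS : depends_on S (fun G => [disjoint S & G]%:R : R).
  by move=> G; rewrite -!setI_eq0 setICA setIid setIC.
rewrite bern_expU1 //; have [eS|eS] := boolP (e \in S).
  have -> : bern_exp D (fun G => [disjoint S & e |: G]%:R) = 0.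
    rewrite -(bern_exp_cst D 0); apply: eq_bern_exp => G.
    have -> // : [disjoint S & e |: G] = false.
    by apply/negbTE/negP => /disjointFr /(_ eS); rewrite setU11.
  rewrite mulr0 add0r (cardsD1 e) eS exprS; congr (_ * _).
  rewrite -IH ?subDset //.
  (* As e is not in D, it lies in no G: avoiding S and avoiding [S :\ e] are the same. *)
  rewrite /bern_exp; apply: eq_bigr => G; rewrite powersetE => sG.
  congr (_ * _%:R); congr (nat_of_bool _); apply/idP/idP.
    exact/disjointWl/subsetDl.
  move=> dS; rewrite -(setD1K eS) -setI_eq0 setIUl setU_eq0 !setI_eq0 dS andbT.
  by rewrite disjoints1; apply: contra eD; exact: (subsetP sG e).
rewrite (eq_bern_exp D (depends_on_notin eS depS)) -mulrDl addrC subrK mul1r IH //.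
apply/subsetP => i iS; have := subsetP sS i iS.
by rewrite !inE => /predU1P[ie|//]; rewrite -ie iS in eS.
Qed.

Hypothesis q01 : 0 <= q <= 1.

Lemma le_bern_exp D f g : (forall G, G \subset D -> f G <= g G) ->
  bern_exp D f <= bern_exp D g.
Proof.
move=> fg; apply: ler_sum => G; rewrite powersetE => sG.
have /andP[q0 q1] := q01.
apply: ler_wpM2l (fg _ sG); apply: prodr_ge0 => e _.
by case: ifP => // _; rewrite subr_ge0.
Qed.

End BernoulliSubsets.

(** * Breadth-first exploration *)

Section Exploration.
Import mathcomp.boot.fintype mathcomp.boot.finset.
Local Open Scope set_scope.
Local Open Scope ring_scope.
Variable T : finType.
Implicit Types (e : rel T) (s : {set T} * {set T}) (x y v u : T).

(* A state [s] of the exploration is the pair of the ball [s.1] and of the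
   sphere [s.2] on its boundary. *)
Definition new_nbrs e s : {set T} :=
  [set u | (u \notin s.1) && [exists f in s.2, e f u]].

Fixpoint bfs e v k : {set T} * {set T} :=
  if k is k'.+1 then
    ((bfs e v k').1 :|: new_nbrs e (bfs e v k'), new_nbrs e (bfs e v k'))
  else ([set v], [set v]).

Lemma walk0 e x y : walk e 0 x y = (x == y).
Proof.
apply/existsP/eqP => [[p]|<-]; last by exists [tuple]; rewrite /= eqxx.
by rewrite tuple0 /= => /eqP.
Qed.

Lemma walkS e k x y :
  walk e k.+1 x y <-> exists2 z, walk e k x z & e z y.
Proof.
split=> [/existsP[p /andP[]]|[z /existsP[p /andP[pp /eqP pz]] zy]].
  have [z [p' ->]] : exists z, exists p' : k.-tuple T, tval p = rcons p' z.
    case/lastP def_p : (tval p) (size_tuple p) => [//|p' z].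
    rewrite size_rcons => -[sz]; have /eqP sz' := sz.
    by exists z, (Tuple sz').
  rewrite rcons_path last_rcons => /andP[pp pz] /eqP <-.
  by exists (last x p') => //; apply/existsP; exists p'; rewrite pp /=.
apply/existsP; exists [tuple of rcons p y].
by rewrite /= rcons_path last_rcons pp pz zy /=.
Qed.

(** Ball and sphere share one induction: the penultimate vertex of a shortest walk to a new vertex
    lies on the current sphere, since a shorter walk to it would extend to a shorter walk to the new
    vertex. *)
Lemma mem_bfs e v k u :
  (u \in (bfs e v k).1 <-> exists2 j, (j <= k)%N & walk e j v u) /\
  (u \in (bfs e v k).2 <->
     walk e k v u /\ forall j, (j < k)%N -> ~~ walk e j v u).
Proof.
elim: k u => [|k IH] u /=.
  rewrite !inE walk0 eq_sym; split; last by split=> [->|[]].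
  split=> [uv|[j]]; first by exists 0; rewrite ?walk0.
  by rewrite leqn0 => /eqP ->; rewrite walk0.
have ball_no : u \notin (bfs e v k).1 -> forall j, (j < k.+1)%N -> ~~ walk e j v u.
  by move=> uV j jk; apply: contra uV => w; apply/(IH u).1; exists j.
have sph : u \in new_nbrs e (bfs e v k) <->
    walk e k.+1 v u /\ (forall j, (j < k.+1)%N -> ~~ walk e j v u).
  rewrite inE; split=> [/andP[uV /exists_inP[f /(IH f).2[wf _] fu]]|[]].
    by split; [apply/walkS; exists f|exact: ball_no].
  move/walkS => [z wz zu] no; apply/andP; split.
    apply/negP => /(IH u).1[j jk wj].
    by have := no j; rewrite ltnS jk wj => /(_ isT).
  apply/exists_inP; exists z => //; apply/(IH z).2; split=> // j jk.
  apply/negP => wj; have /negP := no j.+1 jk; apply.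
  by apply/walkS; exists z.
split=> //; rewrite inE; split=> [/orP[/(IH u).1[j jk wj]|/sph[w _]]|[j jk wj]].
- by exists j => //; apply: leqW.
- by exists k.+1.
apply/orP; have [|uV] := boolP (u \in (bfs e v k).1); first by left.
right; apply/sph; split; last exact: ball_no.
have := ball_no uV j; rewrite ltnS wj; move: jk; rewrite leq_eqVlt ltnS.
by move=> /predU1P[<-//|-> /(_ isT)].
Qed.

Lemma sphere_size_bfs e v k : sphere_size e v k%:Z = #|(bfs e v k).2|.
Proof.
rewrite /sphere_size; apply: eq_card => u; rewrite inE; apply/idP/idP.
  rewrite /gdist; case: pselect => //= exw /eqP[<-].
  case: ex_minnP => m wm mmin; apply/(mem_bfs e v m u).2; split=> // j jm.
  by apply/negP => /mmin; rewrite leqNgt jm.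
move=> /(mem_bfs e v k u).2[wk no]; rewrite /gdist.
case: pselect => [exw|[]]; last by exists k.
case: ex_minnP => m wm mmin /=; apply/eqP; congr (Some (Posz _)).
apply/eqP; rewrite eqn_leq mmin //= leqNgt.
by apply/negP => /no; rewrite wm.
Qed.

Lemma bfs_sub e v k : (bfs e v k).2 \subset (bfs e v k).1.
Proof.
by apply/subsetP => u /(mem_bfs e v k u).2[w _]; apply/(mem_bfs _ _ _ _).1; exists k.
Qed.

(** The vertices expanded before level k are interior at level k, so the pairs inspected so far all
    meet the interior. *)
Lemma bfs_inner e v j k : (j < k)%N ->
  (bfs e v j).2 \subset (bfs e v k).1 :\: (bfs e v k).2.
Proof.
move=> jk; apply/subsetP => u /(mem_bfs e v j u).2[w _]; rewrite inE.
apply/andP; split; last by apply/(mem_bfs e v k u).1; exists j; rewrite // ltnW.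
by apply/negP => /(mem_bfs e v k u).2[_ /(_ j jk)]; rewrite w.
Qed.

(* The exploration only queries the pairs with an end in the interior. *)
Lemma bfs_local e e' v k :
  (forall x y, x \in (bfs e v k).1 :\: (bfs e v k).2 -> e x y = e' x y) ->
  bfs e' v k = bfs e v k.
Proof.
move=> ee'; suff H j : (j <= k)%N -> bfs e' v j = bfs e v j by exact: H.
elim: j => //= j IH jk; rewrite IH; last exact: ltnW.
have -> // : new_nbrs e' (bfs e v j) = new_nbrs e (bfs e v j).
apply/setP => u; rewrite !inE; congr (_ && _); apply: eq_existsb => f.
have [fF|//] := boolP (f \in _); rewrite ee' //.
exact: subsetP (bfs_inner e v jk) f fF.
Qed.

End Exploration.

(** * Exploration of a random graph: independence and variance *)

Section ExplorationGnp.
Import mathcomp.boot.fintype mathcomp.boot.finset.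
Local Open Scope set_scope.
Local Open Scope ring_scope.
Variables (R : realFieldType) (n : nat) (q : R).
Implicit Types (G : {set {set 'I_n}}) (F V : {set 'I_n}) (u v f : 'I_n).
Implicit Types (s : {set 'I_n} * {set 'I_n}).

Local Notation "''E' f" := (bern_exp q (vpairs n) f)
  (at level 10, f at level 8, format "''E'  f").

Definition star F u : {set {set 'I_n}} := [set [set f; u] | f in F].

Lemma card_star F u : u \notin F -> #|star F u| = #|F|.
Proof.
move=> uF; apply: card_in_imset => f f' fF f'F /setP/(_ f).
rewrite !inE eqxx /= => /esym/orP[/eqP//|/eqP fu].
by rewrite -fu fF in uF.
Qed.

Lemma star_sub F u : u \notin F -> star F u \subset vpairs n.
Proof.
move=> uF; apply/subsetP => p /imsetP[f fF ->]; rewrite inE cards2.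
by have [fu|] := eqVneq f u; rewrite -?fu ?fF in uF *.
Qed.

Lemma disjoint_star F u u' : u \notin F -> u' \notin F -> u != u' ->
  [disjoint star F u & star F u'].
Proof.
move=> uF u'F uu'; rewrite -setI_eq0; apply/eqP/setP => p; rewrite !inE.
apply/negP => /andP[/imsetP[f fF ->]] /imsetP[f' f'F] /setP/(_ u).
rewrite !inE eqxx orbT (negbTE uu') orbF => /esym/eqP uf'.
by rewrite uf' f'F in uF.
Qed.

Definition hit F u G : bool := [exists f in F, adj G f u].

Lemma hitE F u G : hit F u G = ~~ [disjoint star F u & G].
Proof.
rewrite -setI_eq0; apply/exists_inP/set0Pn => [[f fF fu]|[p]].
  by exists [set f; u]; rewrite in_setI (imset_f (fun f => [set f; u]) fF).
by rewrite inE => /andP[/imsetP[f fF ->] fu]; exists f.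
Qed.

Lemma depends_on_hit F u : depends_on (star F u) (hit F u).
Proof. by move=> G; rewrite !hitE -!setI_eq0 setICA setIid setIC. Qed.

Lemma bern_exp_hit F u : u \notin F ->
  'E (fun G => (hit F u G)%:R) = 1 - (1 - q) ^+ #|F|.
Proof.
move=> uF; rewrite -(card_star uF) -(bern_exp_avoid q (star_sub uF)).
rewrite -[X in X - _](bern_exp_cst q (vpairs n)) -mulN1r -bern_expZ -bern_expD.
by apply: eq_bern_exp => G; rewrite hitE; case: disjoint => /=; ring.
Qed.

(** The mean size of the next sphere given the state s: a vertex outside the ball is missed when all
    its pairs with the sphere are absent. *)
Definition mean_nbrs s : R := #|~: s.1|%:R * (1 - (1 - q) ^+ #|s.2|).

Lemma card_new_nbrs s G :
  #|new_nbrs (adj G) s|%:R = \sum_(u in ~: s.1) (hit s.2 u G)%:R :> R.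
Proof.
rewrite -sum1_card natr_sum [RHS]big_mkcond [LHS]big_mkcond.
by apply: eq_bigr => u _; rewrite !inE /hit; case: (u \in s.1) => //=; case: ifP.
Qed.

Hypothesis q01 : 0 <= q <= 1.

Lemma expr1q_bounds m : 0 <= (1 - q) ^+ m <= 1.
Proof.
have /andP[q0 q1] := q01.
by rewrite exprn_ge0 ?subr_ge0 // exprn_ile1 ?subr_ge0 // gerBl.
Qed.

(** Distinct outer vertices have disjoint stars, so the centred indicators [Y] are independent and
    only the diagonal terms of the square survive. *)
Lemma variance_new_nbrs s : s.2 \subset s.1 ->
  'E (fun G => (#|new_nbrs (adj G) s|%:R - mean_nbrs s) ^+ 2) <= mean_nbrs s.
Proof.
move=> sFV; rewrite /mean_nbrs; set p := 1 - _.
have p01 : 0 <= p <= 1 by have := expr1q_bounds #|s.2|; rewrite /p; lra.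
have uNF u : u \in ~: s.1 -> u \notin s.2.
  by rewrite inE; apply: contra; apply: (subsetP sFV u).
pose Y u G : R := (hit s.2 u G)%:R - p.
have EY u : u \in ~: s.1 -> 'E (Y u) = 0.
  move=> /uNF uF; rewrite bern_expD bern_exp_hit // bern_exp_cst.
  by rewrite /p; ring.
have depY u : depends_on (star s.2 u) (Y u).
  by move=> G; rewrite /Y depends_on_hit.
rewrite (eq_bern_exp _ _ (g := fun G =>
   \sum_(u in ~: s.1) \sum_(u' in ~: s.1) Y u G * Y u' G)); last first.
  move=> G; rewrite -big_distrlr /= -expr2; congr (_ ^+ 2).
  by rewrite /Y sumrB -card_new_nbrs sumr_const mulr_natl.
rewrite bern_exp_sum -sum1_card natr_sum mulr_suml; apply: ler_sum => u uV.
rewrite bern_exp_sum (bigD1 u) //= big1 => [|u' /andP[u'V u'u]]; last first.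
  rewrite (@bern_exp_indep _ _ _ _ (star s.2 u) (star s.2 u')) ?EY ?mul0r //.
  by rewrite disjoint_star ?uNF // eq_sym.
(* An indicator h satisfies h^2 = h, hence (h - p)^2 = (1 - 2 p) h + p^2, of mean p (1 - p) <= p. *)
rewrite addr0 mul1r (eq_bern_exp _ _ (g := fun G =>
   (1 - 2 * p) * (hit s.2 u G)%:R + p ^+ 2)); last first.
  by move=> G; rewrite /Y; case: hit => /=; ring.
rewrite bern_expD bern_expZ bern_exp_cst bern_exp_hit ?uNF // -/p.
by have := sqr_ge0 p; nra.
Qed.

Lemma chebyshev_new_nbrs s (t : R) : s.2 \subset s.1 -> 0 < t ->
  'E (fun G => (t <= `|#|new_nbrs (adj G) s|%:R - mean_nbrs s|)%R%:R) <=
  mean_nbrs s / t ^+ 2.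
Proof.
move=> sFV t0; rewrite ler_pdivlMr ?exprn_gt0 // mulrC -bern_expZ.
apply: le_trans (variance_new_nbrs sFV); apply: le_bern_exp => // G _.
case: (leP t _) => ht; last by rewrite mulr0 sqr_ge0.
by rewrite mulr1 -[leRHS]real_normK ?num_real // ler_sqr // nnegrE ltW.
Qed.

(** The value s fixes the interior, so [bfs_local] compares G with its restriction, whichever of the
    two yields s. *)
Lemma depends_on_bfs v k s :
  depends_on [set p | p :&: (s.1 :\: s.2) != set0]
    (fun G => bfs (adj G) v k == s).
Proof.
set A := [set p | _]; move=> G.
have adjA x y : x \in s.1 :\: s.2 -> adj (G :&: A) x y = adj G x y.
  move=> xs; rewrite /adj inE (_ : _ \in A) ?andbT //.
  by rewrite inE; apply/set0Pn; exists x; rewrite inE xs andbT !inE eqxx.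
by apply/eqP/eqP => es; rewrite -[RHS]es; apply: bfs_local => x y; rewrite es => /adjA.
Qed.

Lemma depends_on_new_nbrs s :
  depends_on (\bigcup_(u in ~: s.1) star s.2 u)
    (fun G => new_nbrs (adj G) s).
Proof.
move=> G; apply/setP => u; rewrite !inE; have [//|uV] := boolP (u \in s.1).
congr (_ && _); apply: eq_existsb => f; have [fF|//] := boolP (f \in _).
rewrite /adj inE; congr (_ && _); case: (_ \in G) => //=.
by apply/bigcupP; exists u; rewrite ?inE // (imset_f (fun f => [set f; u]) fF).
Qed.

(* The next sphere uses fresh edges, so it is independent of the current
   state. *)
Lemma bfs_markov v k (B : {set 'I_n} * {set 'I_n} -> {set 'I_n} -> bool) (c : R) :
  (forall s, s.2 \subset s.1 ->
     'E (fun G => (B s (new_nbrs (adj G) s))%:R) <= c) ->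
  'E (fun G => (B (bfs (adj G) v k) (bfs (adj G) v k.+1).2)%:R) <= c.
Proof.
move=> Bc.
(* Split according to the value s of the state at level k. *)
rewrite (eq_bern_exp _ _ (g := fun G => \sum_s (bfs (adj G) v k == s)%:R *
   (B s (new_nbrs (adj G) s))%:R)); last first.
  move=> G; rewrite (bigD1 (bfs (adj G) v k)) //= eqxx mul1r big1 ?addr0 //.
  by move=> s /negbTE; rewrite eq_sym => ->; rewrite mul0r.
have -> : c = \sum_s 'E (fun G => (bfs (adj G) v k == s)%:R) * c.
  rewrite -mulr_suml -bern_exp_sum -[LHS]mul1r -{1}(bern_exp_cst q (vpairs n) 1).
  congr (_ * _); apply: eq_bern_exp => G.
  rewrite (bigD1 (bfs (adj G) v k)) //= eqxx big1 ?addr0 //.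
  by move=> s /negbTE; rewrite eq_sym => ->.
rewrite bern_exp_sum; apply: ler_sum => s _.
(* A state whose sphere is not inside its ball never occurs, and both sides vanish. *)
have [sFV|sFV] := boolP (s.2 \subset s.1); last first.
  rewrite (eq_bern_exp _ _ (g := fun=> 0)) => [|G]; last first.
    case: eqP => [es|_]; last by rewrite mul0r.
    by rewrite -es bfs_sub in sFV.
  rewrite [X in _ <= X * _](eq_bern_exp _ _ (g := fun=> 0)) => [|G]; last first.
    by case: eqP => [es|//]; rewrite -es bfs_sub in sFV.
  by rewrite bern_exp_cst mul0r.
rewrite (@bern_exp_indep _ _ _ _ [set p | p :&: (s.1 :\: s.2) != set0]
  (\bigcup_(u in ~: s.1) star s.2 u)).
- apply: ler_wpM2l (Bc _ sFV).
  rewrite -(bern_exp_cst q (vpairs n) 0).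
  by apply: le_bern_exp => // G _.
(* A pair joining the sphere to the complement of the ball has no end in the interior. *)
- rewrite -setI_eq0; apply/eqP/setP => p; rewrite !inE; apply/negP => /andP[ps].
  case/bigcupP => u; rewrite inE => uV /imsetP[f fF pE].
  case/set0Pn: ps => w; rewrite pE !inE => /andP[/orP[]/eqP->].
    by rewrite fF.
  by rewrite (negbTE uV) andbF.
- by move=> G; rewrite (depends_on_bfs v k s G).
- by move=> G; rewrite (depends_on_new_nbrs s G).
Qed.

End ExplorationGnp.

(** * One exploration step *)

Section Step.
Import mathcomp.boot.fintype mathcomp.boot.finset.
Local Open Scope set_scope.
Local Open Scope ring_scope.
Variables (R : realType) (n : nat) (q : R).
Hypothesis q01 : 0 <= q <= 1.
Implicit Types (s : {set 'I_n} * {set 'I_n}) (N : {set 'I_n}).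

Local Notation "''E' f" := (bern_exp q (vpairs n) f)
  (at level 10, f at level 8, format "''E'  f").

Lemma gnp_probE (A : pred {set {set 'I_n}}) :
  gnp_prob q A = 'E (fun G => (A G)%:R).
Proof.
rewrite /gnp_prob big_mkcondr; apply: eq_bigr => G _.
by case: ifP => _; rewrite /gnp_mass ?mulr1 ?mulr0.
Qed.

(** Union bound: either Q already fails at level k, or Q holds and the next sphere deviates from its
    mean by at least t, which Chebyshev bounds by c. *)
Lemma bfs_step v k (Q Q' : pred ({set 'I_n} * {set 'I_n})) (t c : R) :
  0 < t -> 0 <= c ->
  (forall s, s.2 \subset s.1 -> Q s -> mean_nbrs q s <= c * t ^+ 2 /\
     forall N, `|#|N|%:R - mean_nbrs q s| < t -> Q' (s.1 :|: N, N)) ->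
  'E (fun G => (~~ Q' (bfs (adj G) v k.+1))%:R) <=
  'E (fun G => (~~ Q (bfs (adj G) v k))%:R) + c.
Proof.
move=> t0 c0 H; pose B s N := Q s && ~~ Q' (s.1 :|: N, N).
have Bc : 'E (fun G => (B (bfs (adj G) v k) (bfs (adj G) v k.+1).2)%:R) <= c.
  apply: bfs_markov => // s sFV; have [Qs|Qs] := boolP (Q s); last first.
    rewrite (eq_bern_exp _ _ (g := fun=> 0)) ?bern_exp_cst // => G.
    by rewrite /B (negbTE Qs).
  have [M_le HN] := H s sFV Qs.
  apply: (@le_trans _ _ (mean_nbrs q s / t ^+ 2)); last first.
    by rewrite ler_pdivrMr ?exprn_gt0.
  apply: le_trans (chebyshev_new_nbrs q01 sFV t0); apply: le_bern_exp => // G _.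
  rewrite /B Qs /=; case: (leP t _) => [_|/HN -> //].
  by case: (Q' _); rewrite ?ler01.
apply: le_trans (lerD (lexx _) Bc); rewrite -bern_expD.
apply: le_bern_exp => // G _; rewrite /B /=.
by case: (Q (bfs _ _ _)); case: (Q' _) => /=; rewrite ?addr0 ?add0r ?lerDl ?ler01.
Qed.

Lemma expr1q_ge m : 1 - m%:R * q <= (1 - q) ^+ m.
Proof.
have /andP[q0 q1] := q01.
elim: m => [|m IH]; first by rewrite mul0r subr0 expr0.
rewrite exprS; apply: le_trans (ler_wpM2l _ IH); last by rewrite subr_ge0.
rewrite -natr1; have : 0 <= m%:R * q ^+ 2 by rewrite mulr_ge0 ?exprn_ge0.
by nra.
Qed.

Lemma expr1q_le m : (1 - q) ^+ m <= expR (- (m%:R * q)).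
Proof.
have /andP[q0 q1] := q01.
rewrite -mulrN expRM_natl; apply: lerXn2r; rewrite ?nnegrE ?subr_ge0 ?expR_ge0 //.
exact: expR_ge1Dx.
Qed.

(** Follows from 1 / (1 - q) <= 1 + q + 2 q^2 <= exp (q (1 + 2 q)) for 0 <= q <= 1/2. *)
Lemma expr1q_ge_expR m : q <= 1 / 2 ->
  expR (- (m%:R * q * (1 + 2 * q))) <= (1 - q) ^+ m.
Proof.
move=> q2; have /andP[q0 q1] := q01; rewrite -mulrA -mulrN expRM_natl.
apply: lerXn2r; rewrite ?nnegrE ?subr_ge0 ?expR_ge0 // expRN.
have qp : 0 < 1 - q by lra.
rewrite -[leRHS]invrK lef_pV2 ?posrE ?invr_gt0 ?expR_gt0 //.
apply: le_trans (expR_ge1Dx _).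
by rewrite -div1r ler_pdivrMr //; nra.
Qed.

Lemma expRN_le_inv (y : R) : 0 <= y -> expR (- y) <= (1 + y)^-1.
Proof.
move=> y0; rewrite expRN lef_pV2 ?posrE ?expR_gt0 ?expR_ge1Dx //.
by rewrite ltr_wpDr.
Qed.

Lemma card_setC_real (V : {set 'I_n}) : #|~: V|%:R = n%:R - #|V|%:R :> R.
Proof.
by apply/eqP; rewrite eq_sym subr_eq -natrD addnC cardsC card_ord.
Qed.

(** Here y stands for x^k with x = n q. The upper bound is a union bound; the loss in the lower one
    comes from collisions and from the vertices already in the ball. *)
Lemma mean_nbrs_bounds s (y : R) :
  8 <= n%:R * q -> q * y <= 1 / 30 -> #|s.2|%:R <= 2 * y -> #|s.1|%:R <= 4 * y ->
  #|s.2|%:R * (n%:R * q) * (1 - 4 * (q * y)) <= mean_nbrs q s /\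
  mean_nbrs q s <= #|s.2|%:R * (n%:R * q).
Proof.
have /andP[q0 q1] := q01.
move=> x8 a30; rewrite /mean_nbrs card_setC_real.
have /andP[_ P1] := expr1q_bounds q01 #|s.2|; move: P1 (expr1q_ge #|s.2|).
have mq0 : 0 <= #|s.2|%:R * q by rewrite mulr_ge0.
have := le_trans (expr1q_le #|s.2|) (expRN_le_inv mq0).
have b0 : 0 <= #|s.1|%:R :> R by [].
have bn : #|s.1|%:R <= n%:R :> R by rewrite ler_nat -[leqRHS]card_ord max_card.
move: mq0 b0 bn; set b : R := #|s.1|%:R; set m : R := #|s.2|%:R.
set P := _ ^+ _; set nn : R := n%:R in x8 *.
move=> mq0 b0 bn Pu P1 Pl my by4.
have n0 : 0 <= nn by lra.
(* From (1 - q)^m <= 1 / (1 + m q) and t / (1 + t) >= t (1 - t). *)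
have p_ge : m * q * (1 - m * q) <= 1 - P.
  apply: (@le_trans _ _ (1 - (1 + m * q)^-1)); last lra.
  have h : 0 < 1 + m * q by lra.
  rewrite -(ler_pM2r h) mulrBl mulVf ?gt_eqF //.
  have : 0 <= m * q * (m * q) * (m * q) by rewrite !mulr_ge0.
  by lra.
have mqa : m * q <= 2 * (q * y) by have := ler_wpM2r q0 my; lra.
split; last first.
  apply: (@le_trans _ _ (nn * (1 - P))); last by have := ler_wpM2l n0 Pl; lra.
  by rewrite ler_wpM2r; lra.
(* As n q >= 8, a ball of size at most 4 y holds at most a fraction q y / 2 of the vertices. *)
have b_le : 2 * b <= nn * (q * y).
  have y0 : 0 <= y by lra.
  have := ler_wpM2r y0 x8; lra.
apply: (@le_trans _ _ ((nn - b) * (m * q * (1 - m * q)))); last first.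
  by rewrite ler_wpM2l //; lra.
have -> : m * (nn * q) * (1 - 4 * (q * y)) = (nn * (1 - 4 * (q * y))) * (m * q).
  by ring.
rewrite [leRHS](_ : _ = ((nn - b) * (1 - m * q)) * (m * q)); last by ring.
rewrite ler_wpM2r //.
have : (nn - b) * (1 - 2 * (q * y)) <= (nn - b) * (1 - m * q).
  by rewrite ler_wpM2l; lra.
have : 0 <= b * (q * y) by rewrite !mulr_ge0 //; lra.
have : 0 <= nn * (q * y) by rewrite !mulr_ge0 //; lra.
by lra.
Qed.

End Step.

(** * Concavity of s |-> 1 - exp (- s) *)

Section Concavity.
Variable R : realType.
Implicit Types mu d : R.

(** Combine exp (- d mu) >= 1 - d mu with mu exp (- mu) <= 1 - exp (- mu). *)
Lemma one_minus_expRN_scale mu d : 0 <= mu -> 0 <= d ->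
  1 - expR (- ((1 + d) * mu)) <= (1 + d) * (1 - expR (- mu)).
Proof.
move=> mu0 d0; rewrite mulrDl mul1r opprD expRD.
have h1 := expR_ge1Dx (- (d * mu)).
have h2 : mu * expR (- mu) <= 1 - expR (- mu).
  have := expR_ge1Dx mu; rewrite -(ler_pM2r (expR_gt0 (- mu))) -expRD subrr expR0.
  lra.
have h3 := ler_wpM2l (expR_ge0 (- mu)) h1.
have h4 := ler_wpM2l d0 h2.
by lra.
Qed.

(** The previous bound at (1 - d) mu, scaled by 1 / (1 - d). *)
Lemma one_minus_expRN_shrink mu d : 0 <= mu -> 0 <= d < 1 ->
  (1 - d) * (1 - expR (- mu)) <= 1 - expR (- ((1 - d) * mu)).
Proof.
move=> mu0 /andP[d0 d1]; have d1' : 0 < 1 - d by lra.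
have e0 : 0 <= d / (1 - d) by rewrite divr_ge0 // ltW.
have mu'0 : 0 <= (1 - d) * mu by rewrite mulr_ge0 // ltW.
have := one_minus_expRN_scale mu'0 e0.
have ne : 1 - d != 0 by rewrite gt_eqF.
have E : 1 + d / (1 - d) = (1 - d)^-1 by field.
rewrite E mulKf // => h; have := ler_wpM2l (ltW d1') h.
by rewrite mulVKf.
Qed.

End Concavity.

(** * Sizes of the spheres *)

Section Levels.
Import mathcomp.boot.fintype mathcomp.boot.finset.
Local Open Scope set_scope.
Local Open Scope ring_scope.
(** In the application K + 1 is [dstar] and w is (log log n)^-2. *)
Variables (R : realType) (n : nat) (v : 'I_n) (q w : R) (K : nat).
Local Notation x := (n%:R * q).
Hypothesis q0 : 0 <= q.
Hypothesis x_ge8 : 8 <= x.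
Hypothesis w_gt0 : 0 < w.
Hypothesis w_le : w <= 1 / 30.
Hypothesis q_le : 4 * q <= w.
Hypothesis xw_ge : 4 <= x * w ^+ 2.
Hypothesis xK_le : x ^+ K <= w * n%:R.
Hypothesis xK_ge : w * n%:R <= x ^+ K.+1.

Local Notation "''E' f" := (bern_exp q (vpairs n) f)
  (at level 10, f at level 8, format "''E'  f").

Let q01 : 0 <= q <= 1. Proof. by rewrite q0; have := q_le; have := w_le; lra. Qed.

Let n_gt0 : 0 < n%:R :> R. Proof. by rewrite ltr0n (leq_ltn_trans _ (ltn_ord v)). Qed.

Let x_gt0 : 0 < x. Proof. by have := x_ge8; lra. Qed.

(* Relative error at level [k]: the first term pays for the collisions and the
   exhausted vertices, the second one for the random fluctuations. *)
Definition level_err (k : nat) : R := 8 * (x ^+ k / n%:R) + w * (1 - (1 / 2) ^+ k).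

Definition level_good (k : nat) (s : {set 'I_n} * {set 'I_n}) : bool :=
  [&& (1 - level_err k) * x ^+ k <= #|s.2|%:R,
      #|s.2|%:R <= (1 + level_err k) * x ^+ k & #|s.1|%:R <= 4 * x ^+ k].

Let half_bounds k : 0 < ((1 / 2) ^+ k : R) <= 1.
Proof.
have h0 : 0 < 1 / 2 :> R by lra.
have h1 : 1 / 2 <= 1 :> R by lra.
by rewrite exprn_gt0 // exprn_ile1 // ltW.
Qed.

Lemma level_err_bounds k : (k <= K)%N -> 0 <= level_err k <= 9 * w.
Proof.
move=> kK; rewrite /level_err; have /andP[r0 r1] := half_bounds k.
have z0 : 0 <= x ^+ k / n%:R by rewrite divr_ge0 ?exprn_ge0 // ltW.
have zw : x ^+ k / n%:R <= w.
  rewrite ler_pdivrMr //; apply: le_trans xK_le; apply: ler_weXn2l => //.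
  by have := x_ge8; lra.
have : 0 <= w * (1 - (1 / 2) ^+ k) by rewrite mulr_ge0 ?subr_ge0 // ltW.
have : 0 <= w * (1 / 2) ^+ k by rewrite mulr_ge0 // ltW.
by lra.
Qed.

(** With r = 2^-k and y = x^k, the step from k to k + 1 allows a relative fluctuation w r / 2 and
    fails with probability at most 8 r / (w^2 x); these bounds form a geometric series. *)
Lemma level_prob k : (k <= K)%N ->
  'E (fun G => (~~ level_good k (bfs (adj G) v k))%:R) <=
  16 / (w ^+ 2 * x) * (1 - (1 / 2) ^+ k).
Proof.
elim: k => [_|k IH kK].
  rewrite expr0 subrr mulr0 -(bern_exp_cst q (vpairs n) 0).
  apply: le_bern_exp => // G _; rewrite /level_good /= !cards1.
  have /andP[e0 _] := level_err_bounds (leq0n K).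
  by rewrite !expr0 (_ : [&& _, _ & _]) //; apply/and3P; split; lra.
have {}IH := IH (ltnW kK).
have /andP[e0 e1] := level_err_bounds (ltnW kK).
have /andP[_ e1'] := level_err_bounds kK.
move: e0 e1 e1' IH; set Q := level_good k; set Q' := level_good k.+1.
rewrite /level_err (exprS x) (exprS (1 / 2)); set y := x ^+ k; set r := (1 / 2) ^+ k.
have /andP[r0 r1] : 0 < r <= 1 := half_bounds k.
have y0 : 0 < y by rewrite exprn_gt0.
(* This is (x / 8)^k >= 1: the growth of the spheres beats the shrinking tolerances. *)
have r3y : 1 <= r ^+ 3 * y.
  rewrite /r /y -exprM mulnC exprM -exprMn; apply: exprn_ege1.
  by have := x_ge8; lra.
set e := _ + w * (1 - r); set e' := _ + w * (1 - _).
move=> e0 e1 e1' IH.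
(* The new error absorbs the old one, the loss 4 q y in the mean and the fluctuation. *)
have ee' : e + 4 * (q * y) + w * (r / 2) <= e'.
  rewrite /e /e'; have -> : q * y = x * (y / n%:R) by field; rewrite gt_eqF.
  rewrite -!mulrA; set z := y / _.
  have z0 : 0 <= z by rewrite divr_ge0 // ltW.
  have := ler_wpM2r z0 x_ge8; lra.
have wr0 : 0 < w * (r / 2) by rewrite mulr_gt0 ?divr_gt0.
have t0 : 0 < w * (r / 2) * (x * y) by rewrite (mulr_gt0 wr0) // (mulr_gt0 x_gt0).
have c0 : 0 <= 16 / (w ^+ 2 * x) * (r / 2).
  by rewrite mulr_ge0 ?divr_ge0 ?mulr_ge0 ?exprn_ge0 // ltW.
have -> : 16 / (w ^+ 2 * x) * (1 - 1 / 2 * r) =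
   16 / (w ^+ 2 * x) * (1 - r) + 16 / (w ^+ 2 * x) * (r / 2).
  by rewrite -mulrDr; congr (_ * _); lra.
apply: le_trans (lerD IH (lexx _)).
apply: (@bfs_step _ _ _ q01 v k Q Q' _ _ t0 c0) => s sFV.
rewrite /Q /level_good /level_err -/y -/r -/e => /and3P[m_ge m_le b_le].
have wle := w_le; have x8 := x_ge8.
have qy : q * y <= w.
  rewrite -(ler_pM2r n_gt0); apply: le_trans xK_le.
  rewrite mulrAC [q * _]mulrC -exprS; apply: ler_weXn2l => //; lra.
have qy0 : 0 <= q * y by rewrite mulr_ge0 // ltW.
have m2 : #|s.2|%:R <= 2 * y.
  by apply: le_trans m_le _; apply: ler_wpM2r; [exact: ltW | lra].
have qy30 : q * y <= 1 / 30 by lra.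
have [M_ge M_le] := mean_nbrs_bounds q01 x8 qy30 m2 b_le.
set m : R := #|s.2|%:R in m_ge m_le m2 M_ge M_le *.
have xy0 : 0 < x * y by rewrite (mulr_gt0 x_gt0).
split.
  apply: (le_trans M_le).
  have -> : 16 / (w ^+ 2 * x) * (r / 2) * (w * (r / 2) * (x * y)) ^+ 2 =
     2 * (x * y) * (r ^+ 3 * y).
    by field; rewrite !gt_eqF //=; move: x_gt0; rewrite pmulr_rgt0.
  apply: (@le_trans _ _ (2 * (x * y))).
    by have := ler_wpM2r (ltW x_gt0) m2; lra.
  by rewrite ler_peMr //; lra.
move=> N; rewrite ltr_distl => /andP[N_ge N_le].
rewrite /Q' /level_good /level_err /= !exprS -/y -/r -/e'.
have N_le' : #|N|%:R <= (1 + e') * (x * y).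
  have : m * x <= (1 + e) * (x * y).
    by have := ler_wpM2r (ltW x_gt0) m_le; lra.
  have : (e + w * (r / 2)) * (x * y) <= e' * (x * y).
    by apply: ler_wpM2r; [exact: ltW | lra].
  by lra.
apply/and3P; split=> //.
- have h1 : (1 - e) * (x * y) * (1 - 4 * (q * y)) <= m * x * (1 - 4 * (q * y)).
    apply: ler_wpM2r; first lra.
    by have := ler_wpM2r (ltW x_gt0) m_ge; lra.
  have h2 : (e + 4 * (q * y) + w * (r / 2)) * (x * y) <= e' * (x * y).
    by apply: ler_wpM2r => //; exact: ltW.
  have h3 : 0 <= e * (4 * (q * y)) * (x * y) by rewrite !mulr_ge0 // ltW.
  by lra.
(* The ball has at most 4 y + 2 x y <= 4 x y vertices. *)
- apply: (@le_trans _ _ (#|s.1|%:R + #|N|%:R)).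
    by rewrite -natrD ler_nat cardsU leq_subr.
  have : (1 + e') * (x * y) <= 2 * (x * y).
    by apply: ler_wpM2r; [exact: ltW | lra].
  have := ler_wpM2r (ltW y0) x8; lra.
Qed.

(** When K + 1 is [dstar], these are log (1 / lambda) and 1 - lambda. *)
Local Notation mu := (x ^+ K.+1 / n%:R).
Local Notation g := (1 - expR (- mu)).

Let mu_ge : w <= mu. Proof. by rewrite ler_pdivlMr. Qed.

Let g_ge : w / 2 <= g.
Proof.
have h : expR (- mu) <= expR (- w) by rewrite ler_expR lerN2.
have := le_trans h (expRN_le_inv (ltW w_gt0)).
suff : (1 + w)^-1 <= 1 - w / 2 by lra.
rewrite -div1r ler_pdivrMr; last by have := w_gt0; lra.
have : 0 <= w * w by rewrite mulr_ge0 // ltW.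
have := w_le; have := mulr_ge0 (ltW w_gt0) (_ : 0 <= 1 / 30 - w); rewrite subr_ge0 w_le => /(_ isT).
by lra.
Qed.

Let g_gt0 : 0 < g. Proof. by have := g_ge; have := w_gt0; lra. Qed.

Let g_le1 : g <= 1. Proof. by rewrite gerBl expR_ge0. Qed.

(** The last two conditions locate the ball size as well, hence the number of vertices left for the
    final step. *)
Definition bulk_good (s : {set 'I_n} * {set 'I_n}) : bool :=
  [&& `|#|s.2|%:R - g * n%:R| <= 15 * w * (g * n%:R),
      #|s.2|%:R <= #|s.1|%:R :> R & #|s.1|%:R <= #|s.2|%:R + 4 * w * n%:R].

Lemma bulk_prob :
  'E (fun G => (~~ bulk_good (bfs (adj G) v K.+1))%:R) <=
  16 / (w ^+ 2 * x) + 4 / (w ^+ 3 * n%:R).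
Proof.
have wle := w_le; have w0 := w_gt0; have x8 := x_ge8; have n0 := n_gt0.
have q_ge0 := q0.
have g0 := g_gt0; have gge := g_ge.
have gn0 : 0 < g * n%:R by rewrite mulr_gt0.
have t0 : 0 < w * (g * n%:R) by rewrite mulr_gt0.
have c0 : 0 <= 4 / (w ^+ 3 * n%:R).
  by rewrite divr_ge0 // mulr_ge0 ?exprn_ge0 // ltW.
have P0 : 'E (fun G => (~~ level_good K (bfs (adj G) v K))%:R) <= 16 / (w ^+ 2 * x).
  apply: le_trans (level_prob (leqnn K)) _.
  have /andP[r0 r1] := half_bounds K.
  rewrite ler_piMr ?gerBl ?(ltW r0) //.
  by rewrite divr_ge0 // mulr_ge0 ?exprn_ge0 ?(ltW x_gt0) // ltW.
apply: le_trans (lerD P0 (lexx _)).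
apply: (@bfs_step _ _ _ q01 v K (level_good K) bulk_good _ _ t0 c0) => s sFV.
have /andP[e0 e1] := level_err_bounds (leqnn K).
move=> /and3P[m_ge m_le b_le].
have qyE : q * x ^+ K = mu by rewrite exprS; field; rewrite gt_eqF.
have b_le' : #|s.1|%:R <= 4 * w * n%:R by have := xK_le; lra.
set p := 1 - (1 - q) ^+ #|s.2|.
have y0 : 0 < x ^+ K by rewrite exprn_gt0.
have mu0 : 0 <= mu by rewrite -qyE mulr_ge0 // ltW.
(* The sphere size costs 9 w, and replacing 1 - q by an exponential costs at most w. *)
have p_le : p <= (1 + 10 * w) * g.
  have d0 : 0 <= 10 * w by lra.
  apply: le_trans (one_minus_expRN_scale mu0 d0); rewrite lerD2l lerN2.
  have q2 : q <= 1 / 2 by have := q_le; lra.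
  apply: le_trans (expr1q_ge_expR q01 #|s.2| q2); rewrite ler_expR lerN2.
  have -> : (1 + 10 * w) * mu = (1 + 10 * w) * x ^+ K * q by rewrite -qyE; ring.
  rewrite -mulrA [q * _]mulrC mulrA; apply: ler_wpM2r => //.
  apply: (@le_trans _ _ ((1 + 9 * w) * x ^+ K * (1 + 2 * q))).
    apply: ler_wpM2r; first by lra.
    apply: le_trans m_le _; apply: ler_wpM2r; first exact: ltW.
    by lra.
  rewrite mulrAC; apply: ler_wpM2r; first exact: ltW.
  have : w * q <= 1 / 30 * q by apply: ler_wpM2r.
  by have := q_le; lra.
have p_ge : (1 - 9 * w) * g <= p.
  have d01 : 0 <= 9 * w < 1 by lra.
  apply: (le_trans (one_minus_expRN_shrink mu0 d01)); rewrite lerD2l lerN2.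
  apply: le_trans (expr1q_le q01 #|s.2|) _; rewrite ler_expR lerN2.
  rewrite -qyE [q * _]mulrC mulrA; apply: ler_wpM2r => //.
  by apply: le_trans m_ge; apply: ler_wpM2r; [exact: ltW|lra].
have p0 : 0 <= p by have := expr1q_bounds q01 #|s.2|; rewrite /p; lra.
have M_le : mean_nbrs q s <= (1 + 10 * w) * (g * n%:R).
  rewrite /mean_nbrs card_setC_real -/p; apply: (@le_trans _ _ (n%:R * p)).
    by apply: ler_wpM2r => //; rewrite gerBl.
  by have := ler_wpM2l (ltW n0) p_le; lra.
(* Here 13 = 9 + 4: the sphere size, and the at most 4 w n vertices already in the ball. *)
have M_ge : (1 - 13 * w) * (g * n%:R) <= mean_nbrs q s.
  rewrite /mean_nbrs card_setC_real -/p.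
  apply: (@le_trans _ _ (n%:R * (1 - 4 * w) * p)); last first.
    by apply: ler_wpM2r => //; lra.
  apply: (@le_trans _ _ (n%:R * (1 - 4 * w) * ((1 - 9 * w) * g))); last first.
    by apply: ler_wpM2l => //; rewrite mulr_ge0 //; lra.
  have : 0 <= (w * w) * (g * n%:R) by rewrite !mulr_ge0 // ltW.
  by lra.
have wgn : w * (g * n%:R) <= 1 / 30 * (g * n%:R) by rewrite ler_pM2r.
split.
  apply: (le_trans M_le).
  have -> : 4 / (w ^+ 3 * n%:R) * (w * (g * n%:R)) ^+ 2 = (g * n%:R) * (4 * g / w).
    by field; rewrite !gt_eqF.
  rewrite mulrC; apply: ler_wpM2l; first exact: ltW.
  by rewrite ler_pdivlMr //; have := ler_wpM2r (ltW w0) wle; lra.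
move=> N; rewrite ltr_distl => /andP[N_ge N_le].
rewrite /bulk_good /=; apply/and3P; split.
- by rewrite ler_distl; apply/andP; split; lra.
- by rewrite ler_nat subset_leq_card // subsetUr.
- apply: (@le_trans _ _ (#|s.1|%:R + #|N|%:R)); last by lra.
  by rewrite -natrD ler_nat cardsU leq_subr.
Qed.

(** The error is relative to n, since exp (- mu) may be very small. *)
Definition tail_good (s : {set 'I_n} * {set 'I_n}) : bool :=
  `|#|s.2|%:R - expR (- mu) * n%:R| <= 21 * w * n%:R.

Lemma tail_prob :
  'E (fun G => (~~ tail_good (bfs (adj G) v K.+2))%:R) <=
  'E (fun G => (~~ bulk_good (bfs (adj G) v K.+1))%:R) + 1 / (w ^+ 2 * n%:R).
Proof.
have wle := w_le; have w0 := w_gt0; have x8 := x_ge8; have n0 := n_gt0.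
have q_ge0 := q0.
have g0 := g_gt0; have gge := g_ge; have g1 := g_le1.
have gn0 : 0 < g * n%:R by rewrite mulr_gt0.
have t0 : 0 < w * n%:R by rewrite mulr_gt0.
have c0 : 0 <= 1 / (w ^+ 2 * n%:R).
  by rewrite divr_ge0 // mulr_ge0 ?exprn_ge0 // ltW.
apply: (@bfs_step _ _ _ q01 v K.+1 bulk_good tail_good _ _ t0 c0) => s sFV.
rewrite /bulk_good ler_distl => /and3P[/andP[m_ge m_le] b_ge b_le].
have wgn : w * (g * n%:R) <= 1 / 30 * (g * n%:R) by rewrite ler_pM2r.
have wgn' : w * (g * n%:R) <= w * n%:R.
  by apply: ler_wpM2l; [exact: ltW | rewrite ler_piMl // ltW].
set P := (1 - q) ^+ #|s.2|.
(* The sphere has at least g n / 2 >= w n / 4 vertices, so m q >= w x / 4 >= 1 / w. *)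
have P_le : P <= w.
  have mq : w^-1 <= #|s.2|%:R * q.
    apply: (@le_trans _ _ (g * n%:R / 2 * q)); last by apply: ler_wpM2r; lra.
    apply: (@le_trans _ _ (w / 4 * x)).
      by rewrite -div1r ler_pdivrMr //; have := xw_ge; lra.
    by have := ler_wpM2r (ltW x_gt0) gge; lra.
  have w'0 : 0 < w^-1 by rewrite invr_gt0.
  have mq0 : 0 <= #|s.2|%:R * q by rewrite mulr_ge0.
  apply: le_trans (expr1q_le q01 #|s.2|) _.
  apply: le_trans (expRN_le_inv mq0) _.
  by rewrite -[leRHS]invrK lef_pV2 ?posrE //; lra.
have /andP[P0 P1] := expr1q_bounds q01 #|s.2|; rewrite -/P in P0 P1.
have r0 : 0 <= n%:R - #|s.1|%:R :> R by rewrite -card_setC_real.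
have M_le : mean_nbrs q s <= n%:R - #|s.1|%:R.
  by rewrite /mean_nbrs card_setC_real -/P ler_piMr //; lra.
have M_ge : n%:R - #|s.1|%:R - w * n%:R <= mean_nbrs q s.
  rewrite /mean_nbrs card_setC_real -/P.
  have h1 : (n%:R - #|s.1|%:R) * P <= (n%:R - #|s.1|%:R) * w by apply: ler_wpM2l.
  have h2 : (n%:R - #|s.1|%:R) * w <= n%:R * w.
    by apply: ler_wpM2r; [exact: ltW | rewrite gerBl].
  by lra.
split.
  have -> : 1 / (w ^+ 2 * n%:R) * (w * n%:R) ^+ 2 = n%:R by field; rewrite !gt_eqF.
  by apply: le_trans M_le _; rewrite gerBl.
move=> N; rewrite ltr_distl => /andP[N_ge N_le].
(* The constant is 21 = 15 + 4 + 1 + 1: sphere, earlier ball, missed vertices, fluctuation. *)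
by rewrite /tail_good /= ler_distl; apply/andP; split; lra.
Qed.

(** Union bound in which the failure of [bulk_good] counts twice, directly and through [tail_prob]:
    32 = 2 * 16 and 9 = 2 * 4 + 1. *)
Lemma spheres_prob :
  1 - (32 / (w ^+ 2 * x) + 9 / (w ^+ 3 * n%:R)) <=
  'E (fun G => (
    (`|(sphere_size (adj G) v K.+1%:Z)%:R - g * n%:R| <= 15 * w * (g * n%:R))%R &&
    (`|(sphere_size (adj G) v K.+2%:Z)%:R - expR (- mu) * n%:R| <= 21 * w * n%:R)%R)%:R).
Proof.
have w0 := w_gt0; have n0 := n_gt0.
apply: (@le_trans _ _ ('E (fun G => 1 + -1 * ((~~ bulk_good (bfs (adj G) v K.+1))%:R +
    (~~ tail_good (bfs (adj G) v K.+2))%:R)))); last first.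
  apply: le_bern_exp => // G _; rewrite !sphere_size_bfs.
  have [/and3P[-> _ _]|_] := boolP (bulk_good _).
    by rewrite /tail_good; case: (`|_| <= _) => /=; rewrite ?mulr0n ?mulr1n; lra.
  case: (~~ tail_good _) => /=; rewrite ?mulr0n ?mulr1n.
    by apply: (@le_trans _ _ 0); [lra | rewrite ler0n].
  by apply: (@le_trans _ _ 0); [lra | rewrite ler0n].
rewrite bern_expD bern_expZ bern_expD bern_exp_cst.
have h1 := bulk_prob; have h2 := tail_prob.
have h3 : 1 / (w ^+ 2 * n%:R) <= 1 / (w ^+ 3 * n%:R).
  rewrite !div1r lef_pV2 ?posrE ?mulr_gt0 ?exprn_gt0 // ler_pM2r //.
  by rewrite exprS ler_piMl ?exprn_ge0 ?(ltW w0) //; have := w_le; lra.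
have -> : 32 / (w ^+ 2 * x) = 2 * (16 / (w ^+ 2 * x)) by lra.
have -> : 9 / (w ^+ 3 * n%:R) = 2 * (4 / (w ^+ 3 * n%:R)) + 1 / (w ^+ 3 * n%:R).
  by lra.
by lra.
Qed.

End Levels.

(** * Asymptotics *)

Local Open Scope classical_set_scope.
Local Open Scope ring_scope.

Section Asymptotics.
Variable R : realType.
Implicit Types (alpha : nat -> R) (a b : R).

Lemma ereal_lt_fin (M c : \bar R) : (-oo < c)%E -> (M < c)%E ->
  exists2 r : R, (M <= r%:E)%E & (r%:E < c)%E.
Proof.
case: M => [m||] c0 Mc; first by exists m.
  by move: Mc; rewrite ltNge leey.
case: c c0 Mc => [c||//] _ _; last by exists 0; rewrite ?leNye ?ltry.
by exists (c - 1); rewrite ?leNye // lte_fin gtrBl ltr01.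
Qed.

(** The upper limit is an infimum of suprema over neighbourhoods of infinity, so one of these
    suprema is below c. *)
Lemma limn_esup_lt_near (u : nat -> \bar R) (c : \bar R) :
  (-oo < c)%E -> (limn_esup u < c)%E ->
  exists2 r : R, (r%:E < c)%E & \forall n \near \oo, (u n <= r%:E)%E.
Proof.
move=> c0 /ereal_inf_lt[_ [V nV <-] supV].
have [r Mr rc] := ereal_lt_fin c0 supV; exists r => //.
apply: filterS nV => n Vn; apply: le_trans Mr.
by apply: ereal_sup_ubound; exists n.
Qed.

Lemma limn_esup_lty_near alpha : (limn_esup (fun n => (alpha n)%:E) < +oo)%E ->
  exists b : R, \forall n \near \oo, alpha n <= b.
Proof.
move=> /limn_esup_lt_near[//|b _ nb]; exists b.
by apply: filterS nb => n; rewrite lee_fin.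
Qed.

Lemma limn_einf_gt0_near alpha : (0 < limn_einf (fun n => (alpha n)%:E))%E ->
  exists2 a : R, 0 < a & \forall n \near \oo, a <= alpha n.
Proof.
rewrite /limn_einf oppe_gt0 => /limn_esup_lt_near[//|r r0 nr]; exists (- r).
  by rewrite oppr_gt0 -lte_fin.
by apply: filterS nr => n; rewrite /= lee_fin lerNl.
Qed.

Lemma lnln_near (A : R) : \forall n \near \oo, A <= ln (ln (n%:R : R)).
Proof.
apply: filterS (nbhs_infty_ger (expR (expR A))) => n An.
have h1 : expR A <= ln (n%:R : R).
  by rewrite -[leLHS]expRK ler_ln ?posrE ?expR_gt0 // (lt_le_trans _ An) ?expR_gt0.
by rewrite -[leLHS]expRK ler_ln ?posrE ?expR_gt0 // (lt_le_trans _ h1) ?expR_gt0.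
Qed.

(** A threshold above 1 excludes the exponents d <= 0, and minimality gives the strict bound at
    K. *)
Lemma dstar_nat alpha n :
  1 < n%:R / ln (ln n%:R) ^+ 2 :> R -> 1 < n%:R * edge_prob alpha n ->
  exists2 K : nat, dstar alpha n = K.+1%:Z &
    (n%:R * edge_prob alpha n) ^+ K < n%:R / ln (ln n%:R) ^+ 2 <=
    (n%:R * edge_prob alpha n) ^+ K.+1.
Proof.
move=> t1 x1.
have l0 : 0 < ln (ln n%:R) ^+ 2 :> R.
  rewrite lt_neqAle sqr_ge0 andbT eq_sym; apply/eqP => l0.
  by move: t1; rewrite l0 invr0 mulr0 ltr10.
have [dP dmin] := dstarP l0 x1; move: dP dmin; rewrite /dstar_set /=.
set x := _ * edge_prob _ _; set t := _ / _; move: (dstar alpha n) => d dP dmin.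
have x0 : 0 < x by exact: lt_trans x1.
have d0 : 0 < d.
  rewrite ltNge; apply/negP => d0.
  have : x ^ d <= x ^ (0 : int) by rewrite ler_eXz2l.
  by rewrite expr0z => /(le_trans dP); rewrite leNgt t1.
case: d d0 dP dmin => [[|K]|] // _ dP dmin; exists K => //.
apply/andP; split=> //; rewrite ltNge; apply/negP => tK.
by have := dmin K%:Z tK; rewrite lez_nat ltnn.
Qed.

Definition sphere_event alpha (C : R) n (v : 'I_n) (G : {set {set 'I_n}}) :=
  (`|(sphere_size (adj G) v (dstar alpha n))%:R
       / ((1 - lambda alpha n) * n%:R) - 1| < C / ln (ln n%:R)) &&
  (`|(sphere_size (adj G) v (dstar alpha n + 1))%:R / n%:R - lambda alpha n|
     < C / ln (ln n%:R)).

(** With l = log log n, the terms of the threshold serve in turn for w <= 1/30, for x >= 8 l^4, for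
    4 q <= w and for 21 w < C / l. *)
Lemma sphere_event_prob alpha a b (C : R) n (v : 'I_n) :
  0 < a -> 0 < C -> a <= alpha n <= b ->
  30 + 960 / a + 960 * b + 22 / C <= ln (ln (n%:R : R)) ->
  1 - (32 * 120 / a + 288) / ln (ln (n%:R : R)) <=
  gnp_prob (edge_prob alpha n) (sphere_event alpha C v).
Proof.
move=> a0 C0 /andP[a_le le_b]; set L : R := ln n%:R; set l := ln L => l_ge.
have b0 : 0 < b by rewrite (lt_le_trans a0) ?(le_trans a_le).
have a0' : 0 < 960 / a by rewrite divr_gt0 ?ltr0n.
have C0' : 0 < 22 / C by rewrite divr_gt0.
have l30 : 30 <= l by lra.
have l0 : 0 < l by lra.
have n0 : 0 < n%:R :> R by rewrite ltr0n (leq_ltn_trans _ (ltn_ord v)).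
have L0 : 0 < L.
  by rewrite ltNge; apply/negP => /ln0 L0; rewrite /l L0 ltxx in l0.
have LE : L = expR l by rewrite lnK.
have nE : n%:R = expR L by rewrite lnK.
have L_ge : l ^+ 5 / 120 <= L.
  (* One term of the exponential series of L = exp l; likewise for n = exp L below. *)
  by have := expR_ge1Dxn 4 (ltW l0); rewrite -LE (_ : 5`! = 120%N) //; lra.
have n_ge : L ^+ 2 / 2 <= n%:R.
  by have := expR_ge1Dxn 1 (ltW L0); rewrite -nE (_ : 2`! = 2%N) //; lra.
set q := edge_prob alpha n.
have qE : n%:R * q = alpha n * L by rewrite /q /edge_prob mulrC divfK ?gt_eqF.
have x_ge : a * (l ^+ 5 / 120) <= n%:R * q.
  rewrite qE; apply: (@le_trans _ _ (a * L)); first by rewrite ler_pM2l.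
  by rewrite ler_pM2r.
have x_le : n%:R * q <= b * L by rewrite qE ler_pM2r.
have al : 960 <= a * l.
  by rewrite mulrC -ler_pdivrMr //; have := mulr_gt0 a0 a0'; nra.
have l1 : 1 <= l by lra.
have l2 : 1 <= l ^+ 2 by rewrite exprn_ege1.
have l4 : 1 <= l ^+ 4 by rewrite exprn_ege1.
have x_ge' : 8 * l ^+ 4 <= n%:R * q.
  apply: le_trans x_ge.
  have -> : a * (l ^+ 5 / 120) = (a * l) / 120 * l ^+ 4 by field.
  by rewrite ler_pM2r ?exprn_gt0 //; lra.
have x8 : 8 <= n%:R * q by lra.
have q0 : 0 <= q by rewrite -(pmulr_rge0 _ n0); lra.
have w0 : 0 < l ^- 2 by rewrite invr_gt0 exprn_gt0.
have lw : l ^+ 2 * l ^- 2 = 1 by rewrite divff // gt_eqF ?exprn_gt0.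
have ll : 30 * l <= l ^+ 2 by rewrite expr2 ler_pM2r.
have w30 : l ^- 2 <= 1 / 30.
  by rewrite -div1r ler_pdivrMr ?exprn_gt0 //; lra.
have l2L : 8 * b * l ^+ 2 <= L.
  apply: le_trans L_ge.
  have -> : l ^+ 5 / 120 = (l / 120 * l ^+ 2) * l ^+ 2 by field.
  rewrite ler_pM2r ?exprn_gt0 //.
  have bl : 8 * b <= l / 120 by lra.
  by apply: (le_trans bl); rewrite ler_peMr //; lra.
(* From 4 x l^2 <= 4 b L l^2 <= L^2 / 2 <= n. *)
have q_le : 4 * q <= l ^- 2.
  rewrite -div1r ler_pdivlMr ?exprn_gt0 // -(ler_pM2r n0) mul1r.
  apply: le_trans n_ge.
  have h1 := ler_wpM2r (ltW L0) l2L.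
  have h2 := ler_wpM2r (ltW (exprn_gt0 2 l0)) x_le.
  by lra.
have xw : 4 <= n%:R * q * (l ^- 2) ^+ 2.
  rewrite exprVn -exprM ler_pdivlMr ?exprn_gt0 //.
  by have := exprn_gt0 4 l0; lra.
have n_gt : l ^+ 2 < n%:R.
  rewrite nE; apply: (lt_le_trans _ (expR_ge1Dx L)).
  suff : l ^+ 2 <= L by lra.
  apply: le_trans L_ge.
  have -> : l ^+ 5 / 120 = (l * l ^+ 2 / 120) * l ^+ 2 by field.
  rewrite ler_peMl //; first by lra.
  have := ler_wpM2l (ltW l0) ll; have := ler_wpM2r (ltW l0) l30; lra.
have t1 : 1 < n%:R / l ^+ 2 by rewrite ltr_pdivlMr ?exprn_gt0 // mul1r.
have x1 : 1 < n%:R * q by lra.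
have [K dE /andP[xK xK1]] := dstar_nat t1 x1.
rewrite -/q -/L -/l [n%:R / _]mulrC in xK xK1.
have P := spheres_prob v q0 x8 w0 w30 q_le xw (ltW xK) xK1.
(* The first term uses x >= a l^5 / 120, the second n >= (l^4 / 4)^2 / 2. *)
have e_le : 32 / ((l ^- 2) ^+ 2 * (n%:R * q)) + 9 / ((l ^- 2) ^+ 3 * n%:R) <=
    (32 * 120 / a + 288) / l.
  rewrite [leRHS]mulrDl; apply: lerD.
    rewrite ler_pdivrMr; last by rewrite mulr_gt0 ?exprn_gt0 //; lra.
    apply: (@le_trans _ _ (32 * 120 / a / l * ((l ^- 2) ^+ 2 * (a * (l ^+ 5 / 120))))).
      have -> // : 32 * 120 / a / l * ((l ^- 2) ^+ 2 * (a * (l ^+ 5 / 120))) = 32.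
      by field; rewrite !gt_eqF.
    rewrite ler_pM2l ?divr_gt0 // ler_pM2l ?exprn_gt0 //.
  have n_ge' : (l ^+ 4 / 4) ^+ 2 / 2 <= n%:R.
    apply: le_trans n_ge; rewrite ler_pM2r ?invr_gt0 // lerXn2r ?nnegrE ?(ltW L0) //.
      by rewrite divr_ge0 ?exprn_ge0 // ltW.
    apply: le_trans L_ge; have := ler_wpM2r (ltW (exprn_gt0 4 l0)) l30.
    by rewrite [l ^+ 5]exprS; lra.
  rewrite ler_pdivrMr; last by rewrite mulr_gt0 ?exprn_gt0.
  apply: (@le_trans _ _ (288 / l * ((l ^- 2) ^+ 3 * ((l ^+ 4 / 4) ^+ 2 / 2)))).
    have -> : 288 / l * ((l ^- 2) ^+ 3 * ((l ^+ 4 / 4) ^+ 2 / 2)) = 9 * l.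
      by field; rewrite gt_eqF.
    by rewrite ler_peMr.
  by rewrite ler_pM2l ?divr_gt0 // ler_pM2l ?exprn_gt0.
have q01 : 0 <= q <= 1 by lra.
apply: (@le_trans _ _ (1 - (32 / ((l ^- 2) ^+ 2 * (n%:R * q)) + 9 / ((l ^- 2) ^+ 3 * n%:R)))).
  by rewrite lerD2l lerN2.
apply: (le_trans P); rewrite gnp_probE; apply: le_bern_exp => // G _.
rewrite /sphere_event /lambda dE -[(_ + 1)%R]/(Posz (K.+1 + 1)) addn1 -/q -exprnP.
set mu := _ ^+ _ / _; set N1 := (sphere_size _ _ _)%:R; set N2 := (sphere_size _ _ _)%:R.
have g0 : 0 < 1 - expR (- mu).
  rewrite subr_gt0 -expR0 ltr_expR oppr_lt0 divr_gt0 // exprn_gt0 //; lra.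
have wC : 21 * l ^- 2 < C / l.
  have -> : 21 * l ^- 2 = 21 / l / l by rewrite expr2 invfM mulrA.
  rewrite ltr_pM2r ?invr_gt0 // ltr_pdivrMr //.
  suff : 22 <= C * l by lra.
  by rewrite mulrC -ler_pdivrMr //; nra.
rewrite ler_nat; case: (boolP (_ && _)) => // /andP[h1 h2].
rewrite (_ : _ && _ = true) //; apply/andP; split.
  have gn0 : 0 < (1 - expR (- mu)) * n%:R by rewrite mulr_gt0.
  have gn_neq0 : (1 - expR (- mu)) * n%:R != 0 by rewrite gt_eqF.
  rewrite -[X in _ - X](divff gn_neq0) -mulrBl normrM.
  rewrite [X in _ * X]gtr0_norm ?invr_gt0 // ltr_pdivrMr //.
  apply: (le_lt_trans h1); rewrite ltr_pM2r //; lra.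
have -> : N2 / n%:R - expR (- mu) = (N2 - expR (- mu) * n%:R) / n%:R.
  by field; rewrite gt_eqF.
rewrite normrM [X in _ * X]gtr0_norm ?invr_gt0 // ltr_pdivrMr //.
by apply: (le_lt_trans h2); rewrite ltr_pM2r.
Qed.

End Asymptotics.

Theorem theorem3p3 (R : realType) (alpha : nat -> R)
    (alpha_gt0 : forall n : nat, 0 < alpha n)
    (alpha_liminf : (0 < limn_einf (fun n : nat => (alpha n)%:E))%E)
    (alpha_limsup : (limn_esup (fun n : nat => (alpha n)%:E) < +oo)%E)
    (C : R) (C_gt0 : 0 < C) :
  exists2 eps : nat -> R, eps @ \oo --> (0 : R) &
    forall (n : nat) (v1 : 'I_n), nat_of_ord v1 = 0%N ->
      1 - eps n <= gnp_prob (edge_prob alpha n)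
        (fun G : {set {set 'I_n}} =>
           (`| (sphere_size (adj G) v1 (dstar alpha n))%:R
                 / ((1 - lambda alpha n) * n%:R) - 1 |
              < C / ln (ln n%:R))
           && (`| (sphere_size (adj G) v1 (dstar alpha n + 1))%:R / n%:R
                    - lambda alpha n |
                 < C / ln (ln n%:R))).
Proof.
(* For small [n] the parameter [edge_prob alpha n] may exceed 1 and [gnp_prob]
   be negative, so [eps] is read off from the quantity itself. *)
pose eps n : R := if n is m.+1 then
  Num.max 0 (1 - gnp_prob (edge_prob alpha m.+1)
                   (sphere_event alpha C (ord0 : 'I_m.+1))) else 0.
exists eps; last first.
  move=> [|m] v1 v10; first by case: v1 v10.
  have -> : v1 = ord0 by apply: val_inj.
  by rewrite lerBlDr -lerBlDl /eps le_max; apply/orP; right.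
have [a a0 near_a] := limn_einf_gt0_near alpha_liminf.
have [b near_b] := limn_esup_lty_near alpha_limsup.
apply/cvgrPdist_lt => e e0.
pose k := 32 * 120 / a + 288.
have k0 : 0 < k by rewrite addr_gt0 ?divr_gt0 ?mulr_gt0 ?ltr0n.
have ke0 : 0 < 2 * k / e by rewrite divr_gt0 ?mulr_gt0.
(* The extra term 2 k / e makes the failure bound k / log log n smaller than e. *)
have eps_lt n : a <= alpha n -> alpha n <= b ->
    30 + 960 / a + 960 * b + 22 / C + 2 * k / e <= ln (ln (n%:R : R)) ->
    `|0 - eps n| < e.
  case: n => [|m] an bn l_ge; first by rewrite subrr normr0.
  have b0 : 0 < b by rewrite (lt_le_trans a0) ?(le_trans an).
  have a0' : 0 < 960 / a by rewrite divr_gt0 ?ltr0n.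
  have C0' : 0 < 22 / C by rewrite divr_gt0.
  have ab : a <= alpha m.+1 <= b by rewrite an.
  have l_ge1 : 30 + 960 / a + 960 * b + 22 / C <= ln (ln (m.+1%:R : R)) by lra.
  have P := sphere_event_prob ord0 a0 C_gt0 ab l_ge1.
  rewrite sub0r normrN ger0_norm /eps ?le_max ?lexx // gt_max e0 /=.
  have kl : k / ln (ln (m.+1%:R : R)) < e.
    rewrite ltr_pdivrMr; last by lra.
    have : 2 * k / e <= ln (ln (m.+1%:R : R)) by lra.
    by rewrite ler_pdivrMr //; lra.
  by rewrite -/k in P; lra.
near=> n; apply: eps_lt; near: n => //.
exact: lnln_near.
Unshelve. all: by end_near.
Qed.
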